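(* Let $s,t\geq 1$ be integers and let $p,q,l$ be three distinct primes with $p,q$ odd, $p\equiv 3 \pmod 4$, $\mathrm{ord}_{p^s}(l)=\phi(p^s)/2$, $\mathrm{ord}_{q^t}(l)=\phi(q^t)$ and $\gcd(\phi(p^s),\phi(q^t))=2$. Let $0\leq i\leq s-1$ and $0\leq j<j'\leq t$. Then in the ring $\mathbb{F}_l[x]/\langle x^{p^sq^t}-1\rangle$: (i) If $q$ is a quadratic residue modulo $p$, then \[\chi_{ij}\chi_{ij'}^*=\frac{p-3}{4}p^{s-i-1}\phi(q^{t-j'})(\chi_{ij}+\chi_{ij}^* )+\frac{\phi(p^{s-i})}{2}\phi(q^{t-j'})\Big(\sum_{i< k\leq s-1}(\chi_{kj}+\chi_{kj}^* )+\chi_{sj}\Big).\] (ii) If $q$ is a quadratic nonresidue modulo $p$ and $2\nmid j'-j$, then \[\chi_{ij}\chi_{ij'}^*=\frac{p-3}{4}p^{s-i-1}\phi(q^{t-j'})\chi_{ij}+\frac{p+1}{4}p^{s-i-1}\phi(q^{t-j'})\chi_{ij}^*.\] (iii) If $q$ is a quadratic nonresidue modulo $p$ and $2\mid j'-j$, then \[\chi_{ij}\chi_{ij'}^*=\frac{p-3}{4}p^{s-i-1}\phi(q^{t-j'})(\chi_{ij}+\chi_{ij}^* )+\frac{\phi(p^{s-i})}{2}\phi(q^{t-j'})\Big(\sum_{i< k\leq s-1}(\chi_{kj}+\chi_{kj}^* )+\chi_{sj}\Big).\]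
   Context: Here $\phi$ is Euler's phi function (with $\phi(1)=1$) and $\mathrm{ord}_m(k)$ is the multiplicative order of $k$ modulo $m$. Put $n=p^sq^t$. Fix an integer $g$ that is a primitive root both modulo $p^s$ and modulo $q^t$. For an integer $\gamma$, $C_\gamma=\{\gamma l^r \bmod n: r\geq 0\}\subseteq \mathbb{Z}_n$ is the $l$-cyclotomic coset modulo $n$ containing $\gamma$. For $0\leq i\leq s$, $0\leq j\leq t$ set $C_{ij}=C_{p^iq^j}$ and $C_{ij}^*=C_{p^iq^jg}$; in particular $C_{sj}=C_{sj}^*$ and $C_{st}=C_0=\{0\}$. Define elements of $\mathbb{F}_l[x]/\langle x^{n}-1\rangle$ by $\chi_{ij}=\sum_{\alpha\in C_{ij}}x^\alpha$ and $\chi_{ij}^*=\sum_{\alpha\in C_{ij}^*}x^\alpha$; in particular $\chi_{sj}=\chi_{sj}^*$ and $\chi_{st}=1$. Integer coefficients are read in $\mathbb{F}_l$, and empty sums are $0$. *)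

(* Defs.v *)
From HB Require Import structures.
From mathcomp Require Import all_boot all_algebra.

Set Implicit Arguments.
Unset Strict Implicit.
Unset Printing Implicit Defensive.

Import GRing.Theory.
Local Open Scope ring_scope.

(* ord_m(k) = d, for m > 1 (recall that 'Z_0 and 'Z_1 are 'Z_2): d is the least
   positive exponent with k ^ d = 1 mod m; no such d exists unless k is coprime
   to m. *)
Definition mult_order_is (m : nat) (k : int) (d : nat) : bool :=
  d.-primitive_root (k%:~R : 'Z_m).

Definition primitive_root_mod (m : nat) (g : int) : bool :=
  mult_order_is m g (totient m).

Definition quad_residue (p a : nat) : Prop :=
  coprime a p /\ exists x : nat, (x ^ 2 = a %[mod p])%N.

Definition quad_nonresidue (p a : nat) : Prop :=
  coprime a p /\ ~ exists x : nat, (x ^ 2 = a %[mod p])%N.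

(* The orbit of gamma under multiplication by l in Z_n, for n > 1; see
   cyclotomic_cosetP for the description {gamma * l ^ r mod n : r >= 0}. *)
Definition cyclotomic_coset (n l : nat) (gamma : int) : {set 'Z_n} :=
  [set a : 'Z_n | fconnect (fun x : 'Z_n => x * l%:R) gamma%:~R a].

Lemma cyclotomic_cosetP (n l : nat) (gamma : int) (a : 'Z_n) :
  reflect (exists r : nat, a = gamma%:~R * l%:R ^+ r)
          (a \in cyclotomic_coset n l gamma).
Proof.
have iterE r (x : 'Z_n) : iter r (fun x : 'Z_n => x * l%:R) x = x * l%:R ^+ r.
  by elim: r => [|r IHr] /=; rewrite ?mulr1 // IHr exprSr mulrA.
rewrite inE; apply: (iffP idP) => [ga | [r ->]].
  by exists (findex (fun x : 'Z_n => x * l%:R) gamma%:~R a);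
     rewrite -iterE iter_findex.
by rewrite -iterE fconnect_iter.
Qed.

(* F_l[x] / <x^n - 1>, for l prime and n > 0; see mk_monic_XnB1. *)
Notation cyclic_ring l n := {poly %/ ('X^n - 1 : {poly 'F_l})}.

(* {poly %/ h} is a quotient by mk_monic h, which is h itself here. *)
Lemma mk_monic_XnB1 (l n : nat) :
  (0 < n)%N -> mk_monic ('X^n - 1 : {poly 'F_l}) = 'X^n - 1.
Proof.
move=> n_gt0; rewrite /mk_monic -polyC1 size_XnsubC // ltnS n_gt0.
by rewrite monicXnsubC.
Qed.

Definition coset_sum (n l : nat) (gamma : int) : cyclic_ring l n :=
  \sum_(a in cyclotomic_coset n l gamma) 'qX ^+ (a : nat).

Definition chi (p q s t l i j : nat) : cyclic_ring l (p ^ s * q ^ t)%N :=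
  coset_sum (p ^ s * q ^ t)%N l (p ^ i * q ^ j)%N%:Z.

Definition chi_star (p q s t l : nat) (g : int) (i j : nat) :
    cyclic_ring l (p ^ s * q ^ t)%N :=
  coset_sum (p ^ s * q ^ t)%N l ((p ^ i * q ^ j)%N%:Z * g).

(* Main.v *)
Require Import Defs.
From HB Require Import structures.
From mathcomp Require Import all_boot all_algebra.
From mathcomp Require Import ring zify.

Set Implicit Arguments.
Unset Strict Implicit.
Unset Printing Implicit Defensive.

Import GRing.Theory.
Local Open Scope ring_scope.

(* By the Chinese remainder theorem, 'qX ^+ a = u ^+ a * v ^+ a where u and v
   have orders dividing p ^ s and q ^ t. The powers of l form the group of pairs
   (square mod p ^ s, unit mod q ^ t), the two orders of l being coprime because
   (p - 1) / 2 is odd. Hence chi_ij is the product of the sum of the u ^+ x, for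
   x = p ^ i * y with y in a quadratic class, and of the sum of the v ^+ y for y
   of q-valuation j. The second factors multiply by translation invariance. The
   first ones are multiples of the sum of u over the multiples of p ^ i.+1, so
   their products reduce to counting the solutions of a + b = c in F_p with a
   and b of prescribed quadratic characters; since -1 is a nonresidue, there are
   (p - 3) / 4 of them when c != 0 and the characters differ. Multiplication by
   q ^ (j' - j) and by g decides which signs occur. *)

(** * The quadratic character of ['F_p] for [p = 3 mod 4] *)

(** By Euler's criterion this is the Legendre symbol for an odd prime [p]. Its values are kept in
    ['F_p], so that multiplicativity is that of a power map. *)
Definition legendre (p : nat) (x : 'F_p) : 'F_p := x ^+ p.-1./2.

Lemma legendreM (p : nat) (x y : 'F_p) :
  legendre (x * y) = legendre x * legendre y.
Proof. exact: exprMn. Qed.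

Lemma legendreX (p : nat) (x : 'F_p) n : legendre (x ^+ n) = legendre x ^+ n.
Proof. exact: exprAC. Qed.

Lemma natr_Fp_eq (p a b : nat) : prime p ->
  (a%:R == b%:R :> 'F_p) = (a == b %[mod p]).
Proof. by move=> p_pr; rewrite -val_eqE /= !val_Fp_nat. Qed.

Lemma natr_Zp_eq (m a b : nat) : (1 < m)%N ->
  (a%:R == b%:R :> 'Z_m) = (a == b %[mod m]).
Proof. by move=> m_gt1; rewrite -val_eqE /= !val_Zp_nat. Qed.

(** Oddness of [(p - 1) / 2] is what makes -1 a nonresidue. *)
Lemma half_mod4_3 (p : nat) : p = 3 %[mod 4] ->
  p.-1./2 = (2 * ((p - 3) %/ 4) + 1)%N /\ p = (4 * ((p - 3) %/ 4) + 3)%N.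
Proof. lia. Qed.

(** Cancelling [x] in Fermat's [x ^ p = x] shows that the symbol squares to 1. *)
Lemma legendre_neq0 (p : nat) (x : 'F_p) : prime p -> p = 3 %[mod 4] ->
  x != 0 -> (legendre x == 1) || (legendre x == -1).
Proof.
move=> p_pr p4 x_neq0; have [Eh Ep] := half_mod4_3 p4.
rewrite -eqf_sqr expr1n /legendre -exprM.
have xp k : p = k -> x ^+ k == x.
  by move=> <-; rewrite -[x]natr_Zp -natrX natr_Fp_eq // fermat_little.
have /xp : p = (p.-1./2 * 2).+1 by lia.
by rewrite exprSr -subr_eq0 -{3}[x]mul1r -mulrBl mulf_eq0 (negPf x_neq0) orbF
  subr_eq0.
Qed.

Lemma legendre0 (p : nat) : p = 3 %[mod 4] -> legendre (0 : 'F_p) = 0.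
Proof. by move=> /half_mod4_3[Eh _]; rewrite /legendre Eh addn1 expr0n. Qed.

Lemma legendreN (p : nat) (x : 'F_p) : p = 3 %[mod 4] ->
  legendre (- x) = - legendre x.
Proof.
by move=> /half_mod4_3[Eh _]; rewrite /legendre exprNn Eh addn1 exprS exprM
  sqrrN !expr1n mulr1 mulN1r.
Qed.

Lemma Fp_1neqN1 (p : nat) : prime p -> odd p -> (1 == -1 :> 'F_p) = false.
Proof.
move=> p_pr p_odd; rewrite -subr_eq0 opprK.
rewrite (@natr_Fp_eq p 2 0) // mod0n -/(dvdn _ _) dvdn_prime2 //.
by apply: contraTF p_odd => /eqP->.
Qed.

Lemma sum_legendre_split (p : nat) (V : nmodType) (F : 'F_p -> V) :
    prime p -> p = 3 %[mod 4] ->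
  \sum_(x | x != 0) F x =
    \sum_(x | legendre x == 1) F x + \sum_(x | legendre x == -1) F x.
Proof.
move=> p_pr p4; have p_odd : odd p by lia.
rewrite (bigID (fun x => legendre x == 1)) /=; congr (_ + _).
  apply: eq_bigl => x; case: (x =P 0) => [->|_] //=.
  by rewrite legendre0 // eq_sym oner_eq0.
apply: eq_bigl => x; case: (x =P 0) => [->|/eqP x_neq0] /=.
  by rewrite legendre0 // eq_sym oppr_eq0 oner_eq0.
have := legendre_neq0 p_pr p4 x_neq0.
by case: eqP => [->|_] /= => [|->] //; rewrite Fp_1neqN1.
Qed.

(** Negation exchanges the two classes, so each takes half of the [p - 1] nonzero elements. *)
Lemma card_legendre (p : nat) (e : 'F_p) : prime p -> p = 3 %[mod 4] ->
  (e == 1) || (e == -1) -> #|[pred x : 'F_p | legendre x == e]| = p.-1./2.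
Proof.
move=> p_pr p4.
have EN : #|[pred x : 'F_p | legendre x == -1]| =
          #|[pred x : 'F_p | legendre x == 1]|.
  rewrite -!sum1_card (reindex_inj oppr_inj) /=; apply: eq_bigl => x.
  by rewrite !inE legendreN // eqr_opp.
have := @sum_legendre_split p nat (fun=> 1%N) p_pr p4.
have sumE (P : pred 'F_p) : \sum_(x | P x) 1%N = #|P| by exact: sum1_card.
rewrite !sumE cardC1 card_Fp // [X in (_ + X)%R]EN -[RHS]/(_ + _)%N => Ep.
rewrite [X in (X + _)%N](_ : _ = #|[pred x : 'F_p | legendre x == 1]|) // in Ep.
by case/orP=> /eqP->; rewrite ?EN; move: Ep; set c := card _; lia.
Qed.

(** * Counting the representations [c = a + b] with prescribed symbols *)

(** For nonzero [c] and symbols 1 or -1, these are the cyclotomic numbers of order two in additive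
    form. *)
Definition sum_reps (p : nat) (e e' c : 'F_p) : nat :=
  #|[pred a : 'F_p | (legendre a == e) && (legendre (c - a) == e')]|.

Lemma sum_repsE (p : nat) (e e' c : 'F_p) :
  sum_reps e e' c = (\sum_a (legendre a == e)%R * (legendre (c - a) == e')%R)%N.
Proof.
rewrite /sum_reps -sum1_card big_mkcond /=; apply: eq_bigr => a _.
by rewrite inE; case: eqP; case: eqP.
Qed.

Lemma sum_reps0 (p : nat) : prime p -> p = 3 %[mod 4] ->
  sum_reps (1 : 'F_p) (-1) 0 = p.-1./2.
Proof.
move=> p_pr p4; rewrite -(@card_legendre p 1) ?eqxx //; apply: eq_card => a.
by rewrite !inE sub0r legendreN // eqr_opp andbb.
Qed.

(** Multiplying both [a] and [b] by a square preserves their symbols. *)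
Lemma sum_repsMl (p : nat) (d c : 'F_p) : p = 3 %[mod 4] ->
  legendre d = 1 -> sum_reps 1 (-1) (d * c) = sum_reps 1 (-1) c.
Proof.
move=> p4 d1; have d_neq0 : d != 0.
  by apply: contra_eq_neq d1 => ->; rewrite legendre0 // eq_sym oner_eq0.
rewrite !sum_repsE (reindex_inj (mulfI d_neq0)) /=; apply: eq_bigr => a _.
by rewrite -mulrBr !legendreM d1 !mul1r.
Qed.

(** A solution [(a, b)] for [c] gives the solution [(-b, -a)] for [-c]: negation reverses both
    symbols and the exchange restores their order. *)
Lemma sum_repsN (p : nat) (c : 'F_p) : p = 3 %[mod 4] ->
  sum_reps 1 (-1) (- c) = sum_reps 1 (-1) c.
Proof.
move=> p4; rewrite !sum_repsE (reindex_inj (addIr (- c))) /=.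
apply: eq_bigr => a _; rewrite mulnC; congr (_ * _)%N.
  by rewrite opprB addrA addNr sub0r legendreN // eqr_opp.
by rewrite -[a - c]opprB legendreN // -eqr_opp opprK.
Qed.

(* The number of representations is the same for all [c != 0], so it is
   determined by the total number of pairs. *)
Lemma sum_reps_neq0 (p : nat) (c : 'F_p) : prime p -> p = 3 %[mod 4] ->
  c != 0 -> sum_reps 1 (-1) c = ((p - 3) %/ 4)%N.
Proof.
move=> p_pr p4.
have repsE x : x != 0 -> sum_reps (1 : 'F_p) (-1) x = sum_reps (1 : 'F_p) (-1) 1.
  move=> x_neq0; case/orP: (legendre_neq0 p_pr p4 x_neq0) => /eqP x1.
    by rewrite -[x]mulr1 sum_repsMl.
  by rewrite -sum_repsN // -[- x]mulr1 sum_repsMl // legendreN // x1 opprK.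
move/repsE=> ->.
(* Double counting: each pair of elements with symbols 1 and -1 has exactly one sum [c]. *)
have Etot : (\sum_(c : 'F_p) sum_reps 1%R (-1)%R c = p.-1./2 * p.-1./2)%N.
  rewrite (eq_bigr _ (fun x _ => sum_repsE _ _ x)) exchange_big /=.
  rewrite -{1}(@card_legendre p 1) ?eqxx // -sum1_card big_distrl /=.
  rewrite [RHS]big_mkcond; apply: eq_bigr => a _; rewrite -big_distrr /= inE.
  case: eqP => // _; rewrite !mul1n -(@card_legendre p (-1)) ?eqxx ?orbT //.
  rewrite -sum1_card [RHS]big_mkcond (reindex_inj (addIr a)) /=.
  by apply: eq_bigr => x _; rewrite addrK inE; case: eqP.
move: Etot; rewrite (bigD1 0) //= sum_reps0 // (eq_bigr _ repsE) /=.
rewrite sum_nat_const cardC1 card_Fp //; have [Eh Ep] := half_mod4_3 p4.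
set k := ((p - 3) %/ 4)%N in Eh Ep *; rewrite Eh.
(* With [p = 4k + 3] the count reads [(2k + 1)^2 = (2k + 1) + 2(2k + 1)N], whence [N = k]. *)
have -> : p.-1 = (2 * (2 * k + 1))%N by lia.
move: (sum_reps _ _ _) => N; nia.
Qed.

Lemma sum_reps_oppE (p : nat) (e c : 'F_p) : prime p -> p = 3 %[mod 4] ->
  (e == 1) || (e == -1) ->
  sum_reps e (- e) c = if c == 0 then p.-1./2 else ((p - 3) %/ 4)%N.
Proof.
move=> p_pr p4 e1.
have -> : sum_reps e (- e) c = sum_reps 1 (-1) c.
  case/orP: e1 => /eqP-> //; rewrite opprK !sum_repsE.
  rewrite (reindex_inj (can_inj (subKr c))) /=; apply: eq_bigr => a _.
  by rewrite subKr mulnC.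
by case: eqP => [->|/eqP]; [exact: sum_reps0 | exact: sum_reps_neq0].
Qed.

(* If [legendre a = e], then [c - a] is [0] or has symbol [e] or [- e]. *)
Lemma sum_reps_same_opp (p : nat) (e c : 'F_p) : prime p -> p = 3 %[mod 4] ->
  (e == 1) || (e == -1) ->
  (sum_reps e e c + sum_reps e (- e) c + (legendre c == e)%R = p.-1./2)%N.
Proof.
move=> p_pr p4 e1; have p_odd : odd p by lia.
have e_neqN : (e == - e) = false.
  by case/orP: e1 => /eqP->; rewrite ?opprK ?[-1 == _]eq_sym Fp_1neqN1.
have e_neq0 : (0 == e) = false.
  by case/orP: e1 => /eqP->; rewrite eq_sym ?oppr_eq0 oner_eq0.
(* The boolean becomes a count of the [a] with [c - a = 0], so that the identity can be checked for
   each [a] separately. *)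
have -> : nat_of_bool (legendre c == e) =
    (\sum_a (legendre a == e)%R * (c - a == 0)%R)%N.
  rewrite (bigD1 c) //= subrr eqxx muln1 big1 ?addn0 // => a a_neq.
  by rewrite subr_eq0 [c == a]eq_sym (negPf a_neq) muln0.
rewrite !sum_repsE -!big_split -(card_legendre p_pr p4 e1) -sum1_card.
rewrite [RHS]big_mkcond; apply: eq_bigr => a _ /=; rewrite inE -!mulnDr.
case: eqP => // _; rewrite mul1n.
have [->|ca_neq0] := eqVneq (c - a) 0.
  by rewrite legendre0 // e_neq0 -eqr_opp oppr0 opprK e_neq0.
have := legendre_neq0 p_pr p4 ca_neq0.
by case/orP: e1 e_neqN => /eqP-> e_neqN; case/orP => /eqP->;
  rewrite ?eqxx ?opprK ?eqxx ?e_neqN ?[-1 == 1]eq_sym ?Fp_1neqN1.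
Qed.

(** The pairs are grouped by the value [c] of [a + b]. *)
Lemma sum_pairs_reps (p : nat) (V : nmodType) (F : 'F_p -> V) (e e' : 'F_p) :
  \sum_(a | legendre a == e) \sum_(b | legendre b == e') F (a + b) =
  \sum_c F c *+ sum_reps e e' c.
Proof.
under [RHS]eq_bigr do rewrite sum_repsE -sumrMnr.
rewrite [RHS]exchange_big [LHS]big_mkcond; apply: eq_bigr => a _ /=.
case: eqP => _; last by rewrite big1 // => c _ /=; rewrite mul0n mulr0n.
rewrite [RHS](reindex_inj (addrI a)) [LHS]big_mkcond; apply: eq_bigr => b _ /=.
rewrite [a + b - a]addrC addKr mul1n; case: eqP => _ /=.
  by rewrite mulr1n.
by rewrite mulr0n.
Qed.

Lemma sum_pairs_opp (p : nat) (V : nmodType) (F : 'F_p -> V) (e : 'F_p) :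
    prime p -> p = 3 %[mod 4] -> (e == 1) || (e == -1) ->
  \sum_(a | legendre a == e) \sum_(b | legendre b == - e) F (a + b) =
  (\sum_(c | c != 0) F c) *+ ((p - 3) %/ 4) + F 0 *+ p.-1./2.
Proof.
move=> p_pr p4 e1; rewrite sum_pairs_reps (bigD1 0) //= addrC -sumrMnl.
congr (_ + _); last by rewrite sum_reps_oppE // eqxx.
by apply: eq_bigr => c c_neq0; rewrite sum_reps_oppE // (negPf c_neq0).
Qed.

(** By [sum_reps_same_opp], a nonzero [c] has [(p - 1) / 2] representations less the [(p - 3) / 4]
    with opposite symbols, and less one more (from [b = 0]) if [c] has symbol [e]. There is none for
    [c = 0], because [-a] has the symbol opposite to that of [a]. *)
Lemma sum_pairs_same (p : nat) (V : nmodType) (F : 'F_p -> V) (e : 'F_p) :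
    prime p -> p = 3 %[mod 4] -> (e == 1) || (e == -1) ->
  \sum_(a | legendre a == e) \sum_(b | legendre b == e) F (a + b) =
  (\sum_(c | legendre c == e) F c) *+ ((p - 3) %/ 4) +
  (\sum_(c | legendre c == - e) F c) *+ ((p + 1) %/ 4).
Proof.
move=> p_pr p4 e1; have p_odd : odd p by lia.
have [Eh Ep] := half_mod4_3 p4.
have Ek : ((p + 1) %/ 4 = ((p - 3) %/ 4).+1)%N by lia.
have repsE c := sum_reps_same_opp c p_pr p4 e1.
rewrite sum_pairs_reps (bigD1 0) //= (_ : sum_reps e e 0 = 0%N); last first.
  by have := repsE 0; rewrite sum_reps_oppE // eqxx; lia.
rewrite mulr0n add0r sum_legendre_split //.
have split_e (G : 'F_p -> V) :
  \sum_(c | legendre c == 1) G c + \sum_(c | legendre c == -1) G c =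
  \sum_(c | legendre c == e) G c + \sum_(c | legendre c == - e) G c.
  by case/orP: e1 => /eqP-> //; rewrite opprK addrC.
have nz c : legendre c == e -> (c == 0) = false.
  move=> ce; apply: contraTF ce => /eqP->; rewrite legendre0 //.
  by case/orP: e1 => /eqP->; rewrite eq_sym ?oppr_eq0 oner_eq0.
have nzN c : legendre c == - e -> (c == 0) = false.
  by rewrite -eqr_opp opprK -legendreN // => /nz; rewrite oppr_eq0.
rewrite split_e -!sumrMnl; congr (_ + _); apply: eq_bigr => c ce.
  have := repsE c; rewrite sum_reps_oppE // ce nz //= => H.
  by congr (_ *+ _); lia.
have := repsE c; rewrite sum_reps_oppE // (eqP ce) nzN //=.
have -> : (- e == e) = false.
  by case/orP: e1 => /eqP->; rewrite ?opprK ?[-1 == _]eq_sym Fp_1neqN1.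
by move=> H; congr (_ *+ _); lia.
Qed.

(** * Congruences and the powers of [l] modulo [p ^ s] and [q ^ t] *)

Lemma modn_eq_dvd (d m a b : nat) : (d %| m)%N ->
  a = b %[mod m] -> a = b %[mod d].
Proof. by move=> d_m ab; rewrite -(modn_dvdm a d_m) ab modn_dvdm. Qed.

Lemma modn_pmul2l (d m a b : nat) : (0 < d)%N ->
  (d * a = d * b %[mod d * m])%N <-> a = b %[mod m].
Proof.
move=> d_gt0; rewrite -!muln_modr; split=> [/eqP|-> //].
by rewrite eqn_pmul2l // => /eqP.
Qed.

Lemma modn_invl (b m : nat) : (0 < b)%N -> coprime b m ->
  exists b', (b * b' = 1 %[mod m])%N.
Proof.
move=> b_gt0 /(coprimeP _ b_gt0)[[u v] /= uv]; exists u.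
have -> : (b * u = v * m + 1)%N by lia.
by rewrite modnMDl.
Qed.

(* Lets one identify the group generated by [l] by counting, with no lifting
   from [p] to [p ^ s]. *)
Lemma prim_root_powers (R : finNzRingType) (d : nat) (z x : R) (S : {set R}) :
    d.-primitive_root z -> (forall r, z ^+ r \in S) -> (#|S| <= d)%N ->
  x \in S -> exists r, x = z ^+ r.
Proof.
move=> z_prim zS leSd xS; pose f (r : 'I_d) := z ^+ r.
have f_inj : injective f.
  move=> r r' /eqP; rewrite (eq_prim_root_expr z_prim) => /eqP.
  by rewrite !modn_small // => /ord_inj.
have /eqP fE : f @: 'I_d == S.
  rewrite eqEcard card_imset // card_ord leSd andbT.
  by apply/subsetP=> _ /imsetP[r _ ->]; exact: zS.
by move: xS; rewrite -fE => /imsetP[r _ ->]; exists r.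
Qed.

Lemma mult_order_exp (m l d r r' : nat) : (1 < m)%N -> mult_order_is m l d ->
  r = r' %[mod d] -> (l ^ r = l ^ r' %[mod m])%N.
Proof.
move=> m_gt1 ord_l /eqP; rewrite -(eq_prim_root_expr ord_l) -pmulrn -!natrX.
by rewrite natr_Zp_eq // => /eqP.
Qed.

Lemma mult_order_exp1 (m l d : nat) : (1 < m)%N -> mult_order_is m l d ->
  (l ^ d = 1 %[mod m])%N.
Proof.
by move=> m_gt1 /(@mult_order_exp _ _ _ d 0 m_gt1) -> //; rewrite modnn mod0n.
Qed.

Lemma card_unit_Zp (m : nat) : (1 < m)%N ->
  #|[set x : 'Z_m | x \is a GRing.unit]| = totient m.
Proof.
move=> m_gt1; rewrite totient_count_coprime -sum1_card big_mkcond /=.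
rewrite -[m in RHS](Zp_cast m_gt1) big_mkord; apply: eq_bigr => x _.
by rewrite inE -[x]natr_Zp unitZpE // natr_Zp
  -[X in coprime X _](Zp_cast m_gt1); case: coprime.
Qed.

Lemma mult_order_unit (m l d : nat) : (1 < m)%N -> mult_order_is m l d ->
  (l%:R : 'Z_m) \is a GRing.unit.
Proof.
move=> m_gt1 ord_l; have : (l%:R : 'Z_m) ^+ d \is a GRing.unit.
  by have := prim_expr_order ord_l; rewrite -pmulrn => ->; exact: unitr1.
by rewrite unitrX_pos // (prim_order_gt0 ord_l).
Qed.

Lemma mult_order_coprime (p s l d : nat) : (0 < s)%N -> (1 < p ^ s)%N ->
  mult_order_is (p ^ s) l d -> coprime l p.
Proof.
move=> s_gt0 ps_gt1 /(mult_order_unit ps_gt1).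
by rewrite unitZpE // coprime_pexpl // coprime_sym.
Qed.

(** The powers of [l] are units, and there are as many of them as units. *)
Lemma mult_order_totient (m l x : nat) : (1 < m)%N ->
    mult_order_is m l (totient m) -> coprime x m ->
  exists r, (x = l ^ r %[mod m])%N.
Proof.
move=> m_gt1 ord_l co_x.
have l_unit := mult_order_unit m_gt1 ord_l.
have [|||r xE] := @prim_root_powers _ _ _ (x%:R)
  [set x : 'Z_m | x \is a GRing.unit] ord_l.
- by move=> r; rewrite inE unitrX.
- by rewrite card_unit_Zp.
- by rewrite inE unitZpE // coprime_sym.
by exists r; apply/eqP; rewrite -natr_Zp_eq // xE natrX.
Qed.

Lemma half_totient_pfactor (p s : nat) : prime p -> odd p -> (0 < s)%N ->
  (totient (p ^ s) = 2 * (p ^ s.-1 * p.-1./2))%N.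
Proof.
move=> p_pr p_odd s_gt0; rewrite totient_pfactor //.
by rewrite -[in X in (X * _ = _)%N](_ : p.-1./2 * 2 = p.-1)%N; lia.
Qed.

Lemma legendre_mod (p m a b : nat) : prime p -> (p %| m)%N ->
  a = b %[mod m] -> legendre (a%:R : 'F_p) = legendre b%:R.
Proof.
move=> p_pr p_m /(modn_eq_dvd p_m)/eqP.
by rewrite -natr_Fp_eq // => /eqP->.
Qed.

(** The order is [p ^ (s - 1)] times [(p - 1) / 2], so the symbol of [l] has [p ^ (s - 1)]-th power
    1; this exponent is odd, which excludes -1. *)
Lemma legendre_half_order (p s l : nat) : prime p -> p = 3 %[mod 4] ->
    (0 < s)%N -> mult_order_is (p ^ s) l (totient (p ^ s) %/ 2) ->
  legendre (l%:R : 'F_p) = 1.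
Proof.
move=> p_pr p4 s_gt0 ord_l; have p_odd : odd p by lia.
have ps_gt1 : (1 < p ^ s)%N by rewrite -(expn0 p) ltn_exp2l ?prime_gt1.
have := mult_order_exp1 ps_gt1 ord_l.
rewrite half_totient_pfactor // mulKn //.
move=> /(modn_eq_dvd (dvdn_exp s_gt0 (dvdnn p)))/eqP.
rewrite -natr_Fp_eq // natrX mulnC exprM -/(legendre _) => /eqP lX.
have [l0|/(legendre_neq0 p_pr p4)/orP[]/eqP // lN] := eqVneq (l%:R : 'F_p) 0.
  by move: lX; rewrite l0 legendre0 // expr0n expn_eq0 -leqn0 leqNgt prime_gt0.
by move: lX; rewrite lN -signr_odd oddX p_odd orbT expr1.
Qed.

(** The residues of symbol 1 modulo [p ^ s] and their opposites are disjoint sets of units, so the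
    former number at most [totient (p ^ s) / 2]. The powers of [l] lie among them and are that
    many. *)
Lemma mult_order_half (p s l x : nat) : prime p -> p = 3 %[mod 4] ->
    (0 < s)%N -> mult_order_is (p ^ s) l (totient (p ^ s) %/ 2) ->
    legendre (x%:R : 'F_p) = 1 ->
  exists r, (x = l ^ r %[mod p ^ s])%N.
Proof.
move=> p_pr p4 s_gt0 ord_l x1; have p_odd : odd p by lia.
have ps_gt1 : (1 < p ^ s)%N by rewrite -(expn0 p) ltn_exp2l ?prime_gt1.
have p_ps : (p %| p ^ s)%N by rewrite dvdn_exp.
pose S := [set y : 'Z_(p ^ s) | legendre ((y : nat)%:R : 'F_p) == 1].
have legN (y : 'Z_(p ^ s)) :
    legendre ((- y : 'Z_(p ^ s))%:R : 'F_p) = - legendre (y%:R : 'F_p).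
  rewrite -legendreN //; congr legendre; apply/eqP; rewrite -addr_eq0 -natrD.
  rewrite (@natr_Fp_eq _ _ 0) //; apply/eqP/(modn_eq_dvd p_ps)/eqP.
  by rewrite -natr_Zp_eq // natrD !natr_Zp addNr.
have cardS : (#|S| <= totient (p ^ s) %/ 2)%N.
  suff : (#|S| + #|S| <= totient (p ^ s))%N by rewrite leq_divRL //; lia.
  rewrite -{2}(card_imset _ (@oppr_inj 'Z_(p ^ s))) -card_unit_Zp //.
  have /eqP SN0 : S :&: [set - y | y in S] == set0.
    rewrite -subset0; apply/subsetP=> y; rewrite !inE => /andP[y1].
    case/imsetP=> z; rewrite inE => /eqP z1 yz.
    by move: y1; rewrite yz legN z1 eq_sym Fp_1neqN1.
  rewrite -cardsUI SN0 cards0 addn0; apply: subset_leq_card.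
  have unitS (y : 'Z_(p ^ s)) :
      legendre ((y : nat)%:R : 'F_p) == 1 -> y \is a GRing.unit.
    rewrite -[y in y \is a _]natr_Zp unitZpE // coprime_pexpl // prime_coprime //.
    apply: contraL => py; rewrite (_ : (y : nat)%:R = 0 :> 'F_p).
      by rewrite legendre0 // eq_sym oner_eq0.
    by apply/eqP; rewrite (@natr_Fp_eq _ _ 0) // mod0n.
  apply/subsetP=> y; rewrite in_setU !inE.
  case/orP=> [/unitS //|/imsetP[z + ->]]; rewrite inE => /unitS zU.
  by rewrite unitrN.
have [||r xE] := @prim_root_powers _ _ _ (x%:R) S ord_l _ cardS.
- move=> r; rewrite inE -pmulrn -natrX val_Zp_nat //.
  rewrite (@legendre_mod _ _ _ (l ^ r) p_pr p_ps) ?modn_mod // natrX legendreX.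
  by rewrite (legendre_half_order p_pr p4 s_gt0 ord_l) expr1n.
- rewrite inE val_Zp_nat //.
  by rewrite (@legendre_mod _ _ _ x p_pr p_ps) ?modn_mod // x1.
by exists r; apply/eqP; rewrite -natr_Zp_eq // xE natrX.
Qed.

(** * Cyclotomic cosets as products of residue classes *)

(** The exponents found for the two moduli matter only modulo the two orders of [l]. The first order
    is odd, so the gcd hypothesis makes the orders coprime, and the Chinese remainder theorem
    applies to the exponents. *)
Lemma common_power (p q s t l x y : nat) :
    prime p -> prime q -> p = 3 %[mod 4] -> (0 < s)%N -> (0 < t)%N ->
    mult_order_is (p ^ s) l (totient (p ^ s) %/ 2) ->
    mult_order_is (q ^ t) l (totient (q ^ t)) ->
    gcdn (totient (p ^ s)) (totient (q ^ t)) = 2%N ->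
    legendre (x%:R : 'F_p) = 1 -> coprime y (q ^ t) ->
  exists r, (x = l ^ r %[mod p ^ s])%N /\ (y = l ^ r %[mod q ^ t])%N.
Proof.
move=> p_pr q_pr p4 s_gt0 t_gt0 ord_p ord_q gcd2 x1 y_co.
have p_odd : odd p by lia.
have ps_gt1 : (1 < p ^ s)%N by rewrite -(expn0 p) ltn_exp2l ?prime_gt1.
have qt_gt1 : (1 < q ^ t)%N by rewrite -(expn0 q) ltn_exp2l ?prime_gt1.
have [r1 Er1] := mult_order_half p_pr p4 s_gt0 ord_p x1.
have [r2 Er2] := mult_order_totient qt_gt1 ord_q y_co.
have co : coprime (totient (p ^ s) %/ 2) (totient (q ^ t)).
  move: gcd2; rewrite half_totient_pfactor // mulKn //.
  set N := (p ^ s.-1 * _)%N => gcd2.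
  have N_odd : odd N.
    by rewrite oddM oddX p_odd orbT; have [-> _] := half_mod4_3 p4; lia.
  have g2 : (gcdn N (totient (q ^ t)) %| 2)%N.
    by rewrite -gcd2 dvdn_gcd dvdn_gcdr dvdn_mull ?dvdn_gcdl.
  rewrite /coprime; case/primeP: (isT : prime 2) => _ /(_ _ g2)/orP[//|/eqP gN].
  by move: N_odd; rewrite -(divnK (dvdn_gcdl N (totient (q ^ t)))) gN oddM andbF.
exists (chinese (totient (p ^ s) %/ 2) (totient (q ^ t)) r1 r2); split.
  by rewrite Er1; apply: (mult_order_exp ps_gt1 ord_p); rewrite chinese_modl.
by rewrite Er2; apply: (mult_order_exp qt_gt1 ord_q); rewrite chinese_modr.
Qed.

(* For [i = s] the class is that of [0] and [e] plays no role, as in the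
   convention [C_sj = C_sj^*]. *)
Definition res_class (p s i : nat) (e : 'F_p) : pred nat :=
  fun a => (p ^ i %| a)%N &&
    ((i < s)%N ==> (legendre (a %/ p ^ i)%:R == e)).

(** For [q] prime and [j < t] this is exact [q]-valuation [j]. For [j = t] the modulus is 1, and
    what remains is divisibility by [q ^ t], the class of 0. *)
Definition val_class (q t j : nat) : pred nat :=
  fun a => (q ^ j %| a)%N && coprime (a %/ q ^ j) (q ^ (t - j)).

(** Since [l] has symbol 1 and is prime to [q], its powers preserve both classes. Conversely,
    inverting [q ^ j * c] modulo [p ^ s] and [p ^ i * c] modulo [q ^ t] gives the multipliers that
    [gamma] needs, and [common_power] realizes both by one power of [l]. *)
Lemma mem_cosetP (p q s t l i j c : nat) (gamma : int)
    (a : 'Z_(p ^ s * q ^ t)) :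
    prime p -> prime q -> p <> q -> p = 3 %[mod 4] -> (0 < s)%N -> (0 < t)%N ->
    mult_order_is (p ^ s) l (totient (p ^ s) %/ 2) ->
    mult_order_is (q ^ t) l (totient (q ^ t)) ->
    gcdn (totient (p ^ s)) (totient (q ^ t)) = 2%N ->
    (i <= s)%N -> (j <= t)%N ->
    (0 < c)%N -> coprime c p -> coprime c q ->
    gamma%:~R = (p ^ i * q ^ j * c)%:R :> 'Z_(p ^ s * q ^ t) ->
  (a \in cyclotomic_coset (p ^ s * q ^ t) l gamma) =
    res_class s i (legendre ((q ^ j * c)%:R : 'F_p)) a && val_class q t j a.
Proof.
move=> p_pr q_pr p_neq p4 s_gt0 t_gt0 ord_p ord_q gcd2 i_le j_le c_gt0
  co_p co_q gE.
have co_pq : coprime p q by rewrite prime_coprime // dvdn_prime2 //; apply/eqP.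
have p_gt0 := prime_gt0 p_pr; have q_gt0 := prime_gt0 q_pr.
have ps_gt1 : (1 < p ^ s)%N by rewrite -(expn0 p) ltn_exp2l ?prime_gt1.
have qt_gt1 : (1 < q ^ t)%N by rewrite -(expn0 q) ltn_exp2l ?prime_gt1.
have co_l := mult_order_coprime t_gt0 qt_gt1 ord_q.
have n_gt1 : (1 < p ^ s * q ^ t)%N by nia.
have co_n : coprime (p ^ s) (q ^ t) by rewrite coprimeXl ?coprimeXr.
have Ep : (p ^ s = p ^ i * p ^ (s - i))%N by rewrite -expnD subnKC.
have Eq : (q ^ t = q ^ j * q ^ (t - j))%N by rewrite -expnD subnKC.
have qj_gt0 : (0 < q ^ j)%N by rewrite expn_gt0 q_gt0.
have pi_gt0 : (0 < p ^ i)%N by rewrite expn_gt0 p_gt0.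
have modE r : (a = gamma%:~R * l%:R ^+ r) <->
    (a = p ^ i * q ^ j * c * l ^ r %[mod p ^ s] /\
     a = p ^ i * q ^ j * c * l ^ r %[mod q ^ t])%N.
  rewrite gE -natrX -natrM -{1}[a]natr_Zp; split.
    move/eqP; rewrite natr_Zp_eq // chinese_remainder //.
    by case/andP=> /eqP-> /eqP->.
  move=> [Ea Eb]; apply/eqP; rewrite natr_Zp_eq // chinese_remainder //.
  by rewrite Ea Eb !eqxx.
suff main (m : nat) :
    (exists r, m = p ^ i * q ^ j * c * l ^ r %[mod p ^ s] /\
       m = p ^ i * q ^ j * c * l ^ r %[mod q ^ t])%N <->
    res_class s i (legendre ((q ^ j * c)%:R : 'F_p)) m && val_class q t j m.
  apply/cyclotomic_cosetP/idP => [[r /modE mE]|/main[r mE]].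
    by apply/main; exists r.
  by exists r; apply/modE.
move: m => {modE a gE n_gt1} a.
split=> [[r [aEp aEq]]|].
  have pi_a : (p ^ i %| a)%N.
    have /modn_eq_dvd/(_ aEp)/eqP : (p ^ i %| p ^ s)%N by rewrite Ep dvdn_mulr.
    by rewrite -!mulnA modnMr.
  have qj_a : (q ^ j %| a)%N.
    have /modn_eq_dvd/(_ aEq)/eqP : (q ^ j %| q ^ t)%N by rewrite Eq dvdn_mulr.
    by rewrite [(p ^ i * _)%N]mulnC -!mulnA modnMr.
  rewrite /res_class /val_class pi_a qj_a /=; apply/andP; split.
    apply/implyP=> i_lt; apply/eqP.
    move: aEp; rewrite -{1}(divnK pi_a) mulnC Ep -!mulnA.
    move=> /(modn_pmul2l _ _ _ pi_gt0).
    move/(legendre_mod p_pr)=> ->; last by rewrite dvdn_exp ?subn_gt0.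
    rewrite mulnA natrM legendreM natrX legendreX.
    by rewrite (legendre_half_order p_pr p4 s_gt0 ord_p) expr1n mulr1.
  move: aEq; rewrite -{1}(divnK qj_a) mulnC Eq [(p ^ i * _)%N]mulnC -!mulnA.
  move/(modn_pmul2l _ _ _ qj_gt0) => aEq.
  rewrite -coprime_modl aEq coprime_modl coprimeXr // !coprimeMl.
  by rewrite co_q !coprimeXl.
case/andP=> /andP[pi_a leg_a] /andP[qj_a co_a].
have [b bE] : exists b, (q ^ j * c * b = 1 %[mod p ^ s])%N.
  apply: modn_invl; rewrite ?muln_gt0 ?qj_gt0 // coprimeXr // coprimeMl co_p.
  by rewrite coprimeXl // coprime_sym.
have [d dE] : exists d, (p ^ i * c * d = 1 %[mod q ^ t])%N.
  apply: modn_invl; rewrite ?muln_gt0 ?pi_gt0 // coprimeXr // coprimeMl co_q.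
  by rewrite coprimeXl.
have [x x1 xE] : exists2 x, legendre (x%:R : 'F_p) = 1 &
    (a = p ^ i * q ^ j * c * x %[mod p ^ s])%N.
  (* When [i = s] both sides vanish modulo [p ^ s], so 1 serves as the multiplier; the same happens
     below for [j = t]. *)
  move: i_le; rewrite leq_eqVlt => /orP[/eqP Eis|i_lt].
    exists 1%N; first exact: expr1n.
    by move: pi_a; rewrite -!mulnA -Eis modnMr => /eqP.
  exists (a %/ p ^ i * b)%N; last first.
    rewrite -{1}(divnK pi_a) [RHS](_ : _ =
      (a %/ p ^ i * p ^ i * (q ^ j * c * b)) %% p ^ s)%N.
      by rewrite -[RHS]modnMmr bE modnMmr muln1.
    by congr (_ %% _)%N; ring.
  (* [a / p ^ i] has the symbol of [q ^ j * c], whose inverse is [b]. *)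
  rewrite natrM legendreM; move/implyP: leg_a => /(_ i_lt)/eqP->.
  rewrite -legendreM -natrM (@legendre_mod _ _ _ 1 p_pr _ bE) ?dvdn_exp //.
  exact: expr1n.
have [y y_co yE] : exists2 y, coprime y (q ^ t) &
    (a = p ^ i * q ^ j * c * y %[mod q ^ t])%N.
  move: j_le; rewrite leq_eqVlt => /orP[/eqP Ejt|j_lt].
    exists 1%N; first exact: coprime1n.
    by move: qj_a; rewrite [(p ^ i * _)%N]mulnC -!mulnA -Ejt modnMr => /eqP.
  exists (a %/ q ^ j * d)%N; last first.
    rewrite -{1}(divnK qj_a) [RHS](_ : _ =
      (a %/ q ^ j * q ^ j * (p ^ i * c * d)) %% q ^ t)%N.
      by rewrite -[RHS]modnMmr dE modnMmr muln1.
    by congr (_ %% _)%N; ring.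
  rewrite coprimeMl; apply/andP; split.
    by move: co_a; rewrite coprime_pexpr ?subn_gt0 // => /coprimeXr.
  have : coprime (p ^ i * c * d) (q ^ t).
    by rewrite -coprime_modl dE coprime_modl coprime1n.
  by rewrite coprimeMl => /andP[].
have [r [xr yr]] := common_power p_pr q_pr p4 s_gt0 t_gt0 ord_p ord_q gcd2 x1 y_co.
exists r; split.
  by rewrite xE -[LHS]modnMmr xr modnMmr.
by rewrite yE -[LHS]modnMmr yr modnMmr.
Qed.

(** * Splitting sums over residues *)

Lemma sum_blocks (V : nmodType) (m d : nat) (F : nat -> V) :
  \sum_(x < m * d) F x = \sum_(z < m) \sum_(b < d) F (z * d + b)%N.
Proof.
elim: m => [|m IHm]; first by rewrite mul0n !big_ord0.
rewrite big_ord_recr -IHm /= -!(big_mkord xpredT) mulSn addnC.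
rewrite (@big_cat_nat _ _ _ (m * d)) ?leq_addr //=; congr (_ + _).
by rewrite -{1}[(m * d)%N]add0n big_addn addKn !big_mkord;
   apply: eq_bigr => b _; rewrite addnC.
Qed.

Lemma sum_multiples (V : nmodType) (d m : nat) (P : pred nat) (F : nat -> V) :
    (0 < d)%N ->
  \sum_(x < d * m | (d %| x)%N && P (x %/ d)%N) F x =
  \sum_(z < m | P z) F (d * z)%N.
Proof.
case: d => // d _; rewrite big_mkcond.
rewrite mulnC (sum_blocks m d.+1
  (fun x => if (d.+1 %| x)%N && P (x %/ d.+1)%N then F x else 0)).
rewrite [RHS]big_mkcond; apply: eq_bigr => z _.
rewrite big_ord_recl big1 => [|b _] /=.
  by rewrite addr0 addn0 dvdn_mull // mulnK // mulnC.
by rewrite dvdn_addr ?dvdn_mull // gtnNdvd ?ltnS ?ltn_ord.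
Qed.

Lemma sum_Fp (p : nat) (V : nmodType) (F : nat -> V) : prime p ->
  \sum_(b < p) F b = \sum_(x : 'F_p) F x.
Proof. by move=> p_pr; rewrite -!(big_mkord xpredT F) (Fp_cast p_pr). Qed.

(** [u] and [v] are the powers of [z] whose exponents are the Chinese remainder idempotents. They
    are chosen before [A] and [B], so the same pair serves all cosets. *)
Lemma sum_CRT (R : comNzRingType) (m1 m2 : nat) (z : R) :
    coprime m1 m2 -> (0 < m1)%N -> (0 < m2)%N -> z ^+ (m1 * m2) = 1 ->
  exists u v, [/\ u ^+ m1 = 1, v ^+ m2 = 1 & forall A B : pred nat,
  \sum_(a < m1 * m2 | A (a %% m1)%N && B (a %% m2)%N) z ^+ a =
  (\sum_(x < m1 | A x) u ^+ x) * (\sum_(y < m2 | B y) v ^+ y)].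
Proof.
move=> co m1_gt0 m2_gt0 z1.
have zX a b : a = b %[mod m1 * m2] -> z ^+ a = z ^+ b.
  by move=> ab; rewrite -(expr_mod a z1) ab expr_mod.
pose u := z ^+ chinese m1 m2 1 0; pose v := z ^+ chinese m1 m2 0 1.
have u1 : u ^+ m1 = 1.
  rewrite -exprM -(expr0 z); apply: zX; apply/eqP.
  rewrite chinese_remainder // modnMl mod0n eqxx /=.
  by rewrite -modnMml (chinese_modr co) mod0n mul0n mod0n.
have v1 : v ^+ m2 = 1.
  rewrite -exprM -(expr0 z); apply: zX; apply/eqP.
  rewrite chinese_remainder // modnMl !mod0n eqxx andbT.
  by rewrite -modnMml (chinese_modl co) mod0n mul0n mod0n.
exists u, v; split=> // A B.
have zE a : z ^+ a = u ^+ (a %% m1) * v ^+ (a %% m2).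
  rewrite !expr_mod // -!exprM -exprD; apply: zX; apply/eqP.
  rewrite -mulnDl chinese_remainder //; apply/andP.
  split; rewrite -[X in _ == X]modnMml -modnDm
    ?(chinese_modl co) ?(chinese_modr co).
    by rewrite modnDm addn0 modnMml mul1n.
  by rewrite modnDm add0n modnMml mul1n.
rewrite big_distrlr pair_big /=.
pose h (a : 'I_(m1 * m2)) : 'I_m1 * 'I_m2 :=
  (Ordinal (ltn_pmod a m1_gt0), Ordinal (ltn_pmod a m2_gt0)).
have n_gt0 : (0 < m1 * m2)%N by rewrite muln_gt0 m1_gt0.
pose h' (xy : 'I_m1 * 'I_m2) : 'I_(m1 * m2) :=
  Ordinal (ltn_pmod (chinese m1 m2 xy.1 xy.2) n_gt0).
rewrite (reindex h) /=; first by apply: eq_bigr => a _.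
exists h' => [a _|[x y] _].
  apply: val_inj => /=; rewrite -[RHS](modn_small (ltn_ord a)).
  by rewrite [RHS](chinese_mod co).
congr pair; apply: val_inj => /=.
  by rewrite modn_dvdm ?dvdn_mulr // chinese_modl // modn_small.
by rewrite modn_dvdm ?dvdn_mull // chinese_modr // modn_small.
Qed.

(** * Geometric sums and translation invariance *)

Lemma geom_fixed (R : comNzRingType) (N k : nat) (w : R) : w ^+ N = 1 ->
  w ^+ k * (\sum_(z < N) w ^+ z) = \sum_(z < N) w ^+ z.
Proof.
move=> w1; have wE : w * (\sum_(z < N) w ^+ z) = \sum_(z < N) w ^+ z.
  by apply/eqP; rewrite -subr_eq0 -{2}[\sum_(z < N) _]mul1r -mulrBl
    -subrX1 w1 subrr.
by elim: k => [|k IHk]; rewrite ?expr0 ?mul1r // exprS -mulrA IHk.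
Qed.

(** For [j <= t] and [w ^ (q ^ t) = 1] this sums the powers of [w] over the subgroup of multiples of
    [q ^ j] modulo [q ^ t]. It is used for the base [p] as well. *)
Definition geom (R : comNzRingType) (w : R) (q t j : nat) : R :=
  \sum_(z < q ^ (t - j)) (w ^+ (q ^ j)) ^+ z.

Lemma geom_shift (R : comNzRingType) (w : R) (q t j k : nat) : (j <= t)%N ->
  w ^+ (q ^ t) = 1 -> w ^+ (q ^ j * k) * geom w q t j = geom w q t j.
Proof.
move=> j_le w1; rewrite exprM; apply: geom_fixed.
by rewrite -exprM -expnD subnKC.
Qed.

(** Each term of one factor fixes the other factor. *)
Lemma geom_sqr (R : comNzRingType) (w : R) (q t j : nat) : (j <= t)%N ->
  w ^+ (q ^ t) = 1 -> geom w q t j * geom w q t j = geom w q t j *+ q ^ (t - j).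
Proof.
move=> j_le w1; rewrite {1}/geom big_distrl /= -[in RHS](card_ord (q ^ (t - j))).
rewrite -sumr_const; apply: eq_bigr => z _.
by rewrite -exprM geom_shift.
Qed.

(** Dividing the index by [q] splits the multiples of [q ^ j] into translates of those of
    [q ^ (j + 1)]. *)
Lemma geomS (R : comNzRingType) (w : R) (q t j : nat) :
    (j < t)%N -> (0 < q)%N ->
  geom w q t j = geom w q t j.+1 * \sum_(b < q) (w ^+ (q ^ j)) ^+ b.
Proof.
move=> j_lt q_gt0; rewrite /geom -(subnSK j_lt) expnSr.
rewrite (sum_blocks _ _ (fun z => (w ^+ (q ^ j)) ^+ z)) big_distrl /=.
apply: eq_bigr => z _; rewrite big_distrr /=; apply: eq_bigr => b _.
by rewrite exprD -!exprM expnSr -[(q ^ j * q * z)%N]mulnA [(q * z)%N]mulnC.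
Qed.

Definition val_sum (R : comNzRingType) (w : R) (q t j : nat) : R :=
  \sum_(y < q ^ (t - j) | coprime y (q ^ (t - j))) (w ^+ (q ^ j)) ^+ y.

Lemma val_class_sum (R : comNzRingType) (w : R) (q t j : nat) :
    (j <= t)%N -> (0 < q)%N ->
  \sum_(y < q ^ t | val_class q t j y) w ^+ y = val_sum w q t j.
Proof.
move=> j_le q_gt0; have -> : (q ^ t = q ^ j * q ^ (t - j))%N.
  by rewrite -expnD subnKC.
rewrite (@sum_multiples _ _ _ (fun y => coprime y (q ^ (t - j))))
  ?expn_gt0 ?q_gt0 //.
by apply: eq_bigr => y _; rewrite exprM.
Qed.

Lemma val_sumE (R : comNzRingType) (w : R) (q t j : nat) : prime q ->
  (j < t)%N -> val_sum w q t j = geom w q t j - geom w q t j.+1.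
Proof.
move=> q_pr j_lt; have q_gt0 := prime_gt0 q_pr; apply/eqP.
rewrite eq_sym subr_eq /val_sum {1}/geom; set W := w ^+ _.
rewrite (bigID (fun y : 'I_(q ^ (t - j)) => coprime y (q ^ (t - j)))) /=.
apply/eqP; congr (_ + _); rewrite
  (eq_bigl (fun y : 'I_(q ^ (t - j)) => (q %| y)%N && true)).
  have -> : (q ^ (t - j) = q * q ^ (t - j.+1))%N by rewrite -expnS subnSK.
  rewrite (@sum_multiples _ _ _ xpredT) //; apply: eq_bigr => z _.
  by rewrite /W expnSr !exprM.
move=> y; rewrite andbT coprime_pexpr ?subn_gt0 // coprime_sym.
by rewrite prime_coprime // negbK.
Qed.

(** Adding a multiple of [q ^ (j + 1)] does not change a valuation equal to [j]. *)
Lemma val_sum_fixed (R : comNzRingType) (w : R) (q t j k : nat) : prime q ->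
    (j < t)%N -> w ^+ (q ^ t) = 1 ->
  w ^+ (q ^ j.+1 * k) * val_sum w q t j = val_sum w q t j.
Proof.
move=> q_pr j_lt w1; rewrite val_sumE // mulrBr geom_shift //.
by rewrite expnSr -mulnA geom_shift // ltnW.
Qed.

(** As [j < j'], each of the [totient (q ^ (t - j'))] terms of the second factor fixes the first
    one. *)
Lemma val_sumM (R : comNzRingType) (w : R) (q t j j' : nat) : prime q ->
    (j < j')%N -> (j' <= t)%N -> w ^+ (q ^ t) = 1 ->
  val_sum w q t j * val_sum w q t j' = val_sum w q t j *+ totient (q ^ (t - j')).
Proof.
move=> q_pr j_lt j'_le w1; rewrite mulrC {1}/val_sum big_distrl /=.
rewrite totient_count_coprime big_mkord big_mkcond /= -sumrMnr.
apply: eq_bigr => y _; rewrite coprime_sym; case: coprime => //.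
rewrite -exprM; move: (nat_of_ord y) => k.
rewrite -(subnKC j_lt) expnD -mulnA val_sum_fixed //.
exact: leq_trans j_lt j'_le.
Qed.

(** * Sums over quadratic classes and their products *)

Definition res_sum (p s i : nat) (R : comNzRingType) (w : R) (e : 'F_p) : R :=
  \sum_(z < p ^ (s - i) | (i < s)%N ==> (legendre z%:R == e))
    (w ^+ (p ^ i)) ^+ z.

Lemma res_class_sum (p s i : nat) (R : comNzRingType) (w : R) (e : 'F_p) :
    (i <= s)%N -> (0 < p)%N ->
  \sum_(y < p ^ s | res_class s i e y) w ^+ y = res_sum s i w e.
Proof.
move=> i_le p_gt0; have Ep : (p ^ s = p ^ i * p ^ (s - i))%N.
  by rewrite -expnD subnKC.
rewrite /res_class /res_sum; move: (legendre (p := p)) => f.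
rewrite Ep.
rewrite (@sum_multiples _ _ _ (fun y => (i < s)%N ==> (f y%:R == e)))
  ?expn_gt0 ?p_gt0 //.
by apply: eq_bigr => y _; rewrite exprM.
Qed.

(** The symbol of an index depends only on its last digit [b] in base [p]; the other digits
    contribute the factor [geom]. *)
Lemma res_sumE (p s i : nat) (R : comNzRingType) (w : R) (e : 'F_p) :
    prime p -> (i < s)%N ->
  res_sum s i w e =
  geom w p s i.+1 * \sum_(b : 'F_p | legendre b == e) (w ^+ (p ^ i)) ^+ b.
Proof.
move=> p_pr i_lt; rewrite /res_sum big_mkcond /= i_lt /=.
pose F z := if legendre (z%:R : 'F_p) == e then (w ^+ (p ^ i)) ^+ z else 0.
rewrite -[LHS]/(\sum_(z < _) F z).
have -> : (p ^ (s - i) = p ^ (s - i.+1) * p)%N.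
  by rewrite -expnSr subnSK.
rewrite sum_blocks big_distrl /=; apply: eq_bigr => z _.
rewrite big_distrr (sum_Fp (fun b => F (z * p + b)%N) p_pr) [RHS]big_mkcond /=.
apply: eq_bigr => b _; rewrite /F natrD natrM pchar_Fp_0 // mulr0 add0r natr_Zp.
case: eqP => // _.
by rewrite exprD -!exprM expnSr -[(p ^ i * p * z)%N]mulnA [(p * z)%N]mulnC.
Qed.

Lemma geom_top (R : comNzRingType) (w : R) (q t : nat) : geom w q t t = 1.
Proof. by rewrite /geom subnn big_ord1. Qed.

Lemma res_sum_top (p s : nat) (R : comNzRingType) (w : R) (e : 'F_p) :
  res_sum s s w e = 1.
Proof. by rewrite /res_sum subnn ltnn big_mkcond big_ord1. Qed.

(** The two classes cover all last digits except [b = 0], which accounts for the subtracted term.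
    The difference form is meant to telescope. *)
Lemma res_sum_opp (p s i : nat) (R : comNzRingType) (w : R) (e : 'F_p) :
    prime p -> p = 3 %[mod 4] -> (e == 1) || (e == -1) -> (i < s)%N ->
  res_sum s i w e + res_sum s i w (- e) = geom w p s i - geom w p s i.+1.
Proof.
move=> p_pr p4 e1 i_lt; rewrite !res_sumE // -mulrDr (geomS w i_lt) ?prime_gt0 //.
rewrite (sum_Fp (GRing.exp (w ^+ (p ^ i))) p_pr) [in RHS](bigD1 0) //=.
rewrite [X in _ = _ * (X + _) - _]expr0.
rewrite [in RHS]mulrDr mulr1 addrAC subrr add0r sum_legendre_split //; congr (_ * _).
by case/orP: e1 => /eqP->; rewrite ?opprK // addrC.
Qed.

(** Taken from [i + 1], this evaluates the [p]-part of the sum over [k] in the theorem; the final 1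
    is the term of index [s]. *)
Lemma sum_res_sum (p s i : nat) (R : comNzRingType) (w : R) (e : nat -> 'F_p) :
    prime p -> p = 3 %[mod 4] -> (forall k, (e k == 1) || (e k == -1)) ->
    (i <= s)%N ->
  \sum_(i <= k < s) (res_sum s k w (e k) + res_sum s k w (- e k)) + 1 =
  geom w p s i.
Proof.
move=> p_pr p4 e1 i_le; rewrite big_nat.
under eq_bigr => k /andP[_ k_lt].
  rewrite (res_sum_opp w p_pr p4 (e1 k) k_lt) -opprB; over.
rewrite -big_nat sumrN telescope_sumr // geom_top opprB addrC.
by rewrite addrC subrK.
Qed.

(** The power of [p] comes from squaring the common factor [geom w p s i.+1]. *)
Lemma res_sumM (p s i : nat) (R : comNzRingType) (w : R) (e e' : 'F_p) :
    prime p -> (i < s)%N -> w ^+ (p ^ s) = 1 ->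
  res_sum s i w e * res_sum s i w e' =
  (\sum_(a | legendre a == e) \sum_(b | legendre b == e')
     geom w p s i.+1 * (w ^+ (p ^ i)) ^+ (a + b : 'F_p)%R) *+ p ^ (s - i - 1).
Proof.
move=> p_pr i_lt w1; rewrite !res_sumE // mulrACA geom_sqr // -subnDA addn1.
rewrite mulrnAl; congr (_ *+ _).
pose F (b : 'F_p) := geom w p s i.+1 * (w ^+ (p ^ i)) ^+ b.
(* Next to this factor an exponent of [w ^ (p ^ i)] counts only modulo [p], which allows [a + b] to
   be computed in ['F_p]. *)
have modE k : geom w p s i.+1 * (w ^+ (p ^ i)) ^+ k =
              geom w p s i.+1 * (w ^+ (p ^ i)) ^+ (k %% p)%N.
  rewrite {1}(divn_eq k p) exprD mulrA -exprM [(k %/ p * p)%N]mulnC mulnA -expnSr.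
  by rewrite [geom _ _ _ _ * _]mulrC geom_shift.
have FD a b : F (a + b) = F a * (w ^+ (p ^ i)) ^+ b.
  have abE : nat_of_ord (a + b) = ((a + b) %% p)%N.
    by rewrite -{1}[a]natr_Zp -{1}[b]natr_Zp -natrD val_Fp_nat.
  by rewrite /F abE -modE -mulrA -exprD.
rewrite big_distrlr big_distrr; apply: eq_bigr => a _.
rewrite big_distrr; apply: eq_bigr => b _.
exact: etrans (mulrA _ _ _) (esym (FD a b)).
Qed.

(** The last term is the contribution of [a + b = 0], with [(p - 1) / 2 * p ^ (s - i - 1)] rewritten
    as half a totient. *)
Lemma res_sumM_opp (p s i : nat) (R : comNzRingType) (w : R) (e : 'F_p) :
    prime p -> p = 3 %[mod 4] -> (e == 1) || (e == -1) -> (i < s)%N ->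
    w ^+ (p ^ s) = 1 ->
  res_sum s i w e * res_sum s i w (- e) =
  (res_sum s i w e + res_sum s i w (- e)) *+ ((p - 3) %/ 4 * p ^ (s - i - 1)) +
  geom w p s i.+1 *+ (totient (p ^ (s - i)) %/ 2).
Proof.
move=> p_pr p4 e1 i_lt w1; have p_odd : odd p by lia.
pose F (b : 'F_p) := geom w p s i.+1 * (w ^+ (p ^ i)) ^+ b.
rewrite res_sumM // (sum_pairs_opp F) // mulrnDl -!mulrnA.
rewrite half_totient_pfactor ?subn_gt0 // mulKn // -[(s - i).-1%N]subn1
  [in RHS](mulnC _ p.-1./2).
congr (_ *+ _ + _); last first.
  by rewrite /F [X in _ * X]expr0 mulr1.
rewrite -big_distrr sum_legendre_split //= !res_sumE // -mulrDr.
by case/orP: e1 => /eqP->; rewrite ?opprK // addrC.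
Qed.

Lemma res_sumM_same (p s i : nat) (R : comNzRingType) (w : R) (e : 'F_p) :
    prime p -> p = 3 %[mod 4] -> (e == 1) || (e == -1) -> (i < s)%N ->
    w ^+ (p ^ s) = 1 ->
  res_sum s i w e * res_sum s i w e =
  res_sum s i w e *+ ((p - 3) %/ 4 * p ^ (s - i - 1)) +
  res_sum s i w (- e) *+ ((p + 1) %/ 4 * p ^ (s - i - 1)).
Proof.
move=> p_pr p4 e1 i_lt w1.
pose F (b : 'F_p) := geom w p s i.+1 * (w ^+ (p ^ i)) ^+ b.
rewrite res_sumM // (sum_pairs_same F) // mulrnDl -!mulrnA.
by rewrite -!big_distrr !res_sumE.
Qed.

(** * Coset sums in the cyclic ring *)

Lemma qX_exp_n (l n : nat) : (0 < n)%N ->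
  ('qX : cyclic_ring l n) ^+ n = 1.
Proof.
move=> n_gt0; rewrite -[LHS](rmorphXn (in_qpoly ('X^n - 1))); apply: val_inj => /=.
rewrite mk_monic_XnB1 // -[X in Pdiv.Ring.rmodp X _](subrK 1) -{1}['X^n - 1]mul1r.
rewrite Pdiv.RingMonic.rmodp_addl_mul_small ?monicXnsubC //.
by rewrite -polyC1 size_XnsubC // size_polyC oner_eq0.
Qed.

Lemma sum_Zp (n : nat) (V : nmodType) (P : pred nat) (F : nat -> V) : (1 < n)%N ->
  \sum_(a : 'Z_n | P a) F a = \sum_(a < n | P a) F a.
Proof. by move=> n_gt1; rewrite -!(big_mkord P F) (Zp_cast n_gt1). Qed.

(** One pair [u], [v] represents every coset sum, so products of different ones can be compared. The
    cofactor [c] is 1 for [chi] and a representative of [g] for [chi_star]. *)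
Lemma coset_sumE (p q s t l : nat) :
    prime p -> prime q -> p <> q -> p = 3 %[mod 4] -> (0 < s)%N -> (0 < t)%N ->
    mult_order_is (p ^ s) l (totient (p ^ s) %/ 2) ->
    mult_order_is (q ^ t) l (totient (q ^ t)) ->
    gcdn (totient (p ^ s)) (totient (q ^ t)) = 2%N ->
  exists u v : cyclic_ring l (p ^ s * q ^ t)%N,
    [/\ u ^+ (p ^ s) = 1, v ^+ (q ^ t) = 1 &
    forall (i j c : nat) (gamma : int), (i <= s)%N -> (j <= t)%N ->
    (0 < c)%N -> coprime c p -> coprime c q ->
    gamma%:~R = (p ^ i * q ^ j * c)%:R :> 'Z_(p ^ s * q ^ t) ->
    coset_sum (p ^ s * q ^ t) l gamma =
    res_sum s i u (legendre ((q ^ j * c)%:R : 'F_p)) * val_sum v q t j].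
Proof.
move=> p_pr q_pr p_neq p4 s_gt0 t_gt0 ord_p ord_q gcd2.
have p_gt0 := prime_gt0 p_pr; have q_gt0 := prime_gt0 q_pr.
have co_pq : coprime p q by rewrite prime_coprime // dvdn_prime2 //; apply/eqP.
have co_n : coprime (p ^ s) (q ^ t) by rewrite coprimeXl ?coprimeXr.
have ps_gt1 : (1 < p ^ s)%N by rewrite -(expn0 p) ltn_exp2l ?prime_gt1.
have qt_gt1 : (1 < q ^ t)%N by rewrite -(expn0 q) ltn_exp2l ?prime_gt1.
have n_gt1 : (1 < p ^ s * q ^ t)%N by nia.
have [u [v [u1 v1 uvE]]] := sum_CRT co_n (ltnW ps_gt1) (ltnW qt_gt1)
  (@qX_exp_n l _ (ltnW n_gt1)).
exists u, v; split=> // i j c gamma i_le j_le c_gt0 co_p co_q gE.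
rewrite -(val_class_sum v j_le q_gt0) -(res_class_sum u _ i_le p_gt0) -uvE.
set e := legendre _.
pose P a := res_class s i e (a %% p ^ s)%N && val_class q t j (a %% q ^ t)%N.
rewrite /coset_sum (eq_bigl (fun a : 'Z_(p ^ s * q ^ t) => P a)).
  exact: (sum_Zp P (fun a => 'qX ^+ a) n_gt1).
move=> a; rewrite (mem_cosetP _ p_pr q_pr p_neq p4 s_gt0 t_gt0 ord_p ord_q gcd2
  i_le j_le c_gt0 co_p co_q gE) /P -/e; move: (nat_of_ord a) => m.
congr (_ && _).
  rewrite /res_class; congr (_ && _).
    by rewrite /dvdn modn_dvdm // dvdn_exp2l.
  (* Reducing [m] modulo [p ^ s] reduces its quotient by [p ^ i] modulo [p ^ (s - i)], a multiple of
     [p] because [i < s]. *)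
  case: ltnP => //= i_lt; congr (_ == _).
  rewrite [in RHS](_ : p ^ s = p ^ (s - i) * p ^ i)%N -?modn_divl; last first.
    by rewrite -expnD subnK.
  apply: (legendre_mod p_pr (m := p ^ (s - i))); rewrite ?modn_mod //.
  by rewrite dvdn_exp ?subn_gt0.
rewrite /val_class; congr (_ && _).
  by rewrite /dvdn modn_dvdm // dvdn_exp2l.
rewrite [in RHS](_ : q ^ t = q ^ (t - j) * q ^ j)%N -?modn_divl ?coprime_modl //.
by rewrite -expnD subnK.
Qed.

(** * Signs of [g] and [q], and the product formulas *)

(** With symbol 1, [c] would be a power of [l] modulo [p ^ s], and its order would divide
    [totient (p ^ s) / 2]. *)
Lemma legendre_generator (p s l c : nat) : prime p -> p = 3 %[mod 4] ->
    (0 < s)%N -> mult_order_is (p ^ s) l (totient (p ^ s) %/ 2) ->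
    primitive_root_mod (p ^ s) c ->
  legendre (c%:R : 'F_p) = -1.
Proof.
move=> p_pr p4 s_gt0 ord_l ord_c; have p_odd : odd p by lia.
have ps_gt1 : (1 < p ^ s)%N by rewrite -(expn0 p) ltn_exp2l ?prime_gt1.
have co_c := mult_order_coprime s_gt0 ps_gt1 ord_c.
have c_neq0 : c%:R != 0 :> 'F_p.
  by rewrite (@natr_Fp_eq _ _ 0) // mod0n -/(dvdn _ _)
    -prime_coprime // coprime_sym.
case/orP: (legendre_neq0 p_pr p4 c_neq0) => /eqP // c1; exfalso.
have [r cE] := mult_order_half p_pr p4 s_gt0 ord_l c1.
have cN : (c ^ (totient (p ^ s) %/ 2) = 1 %[mod p ^ s])%N.
  rewrite -modnXm cE modnXm -expnM mulnC expnM -modnXm.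
  by rewrite (mult_order_exp1 ps_gt1 ord_l) modnXm exp1n.
have : (totient (p ^ s) %| totient (p ^ s) %/ 2)%N.
  rewrite (prim_order_dvd ord_c) -pmulrn -natrX (@natr_Zp_eq _ _ 1) //.
  exact/eqP.
have tot_gt0 : (0 < totient (p ^ s) %/ 2)%N := prim_order_gt0 ord_l.
by move/(dvdn_leq tot_gt0); rewrite leqNgt ltn_Pdiv // totient_gt0 ltnW.
Qed.

Lemma quad_residue_legendre (p a : nat) : prime p -> p = 3 %[mod 4] ->
  quad_residue p a -> legendre (a%:R : 'F_p) = 1.
Proof.
move=> p_pr p4 [co_a [x /eqP]]; rewrite -natr_Fp_eq // => /eqP xE.
have x_neq0 : x%:R != 0 :> 'F_p.
  apply: contraTneq co_a => x0; rewrite coprime_sym prime_coprime // negbK.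
  by rewrite /dvdn -(mod0n p) -natr_Fp_eq // -xE natrX x0 expr0n.
rewrite -xE natrX legendreX; apply/eqP; rewrite sqrf_eq1.
exact: legendre_neq0.
Qed.

Lemma quad_nonresidue_legendre (p a : nat) : prime p -> p = 3 %[mod 4] ->
  quad_nonresidue p a -> legendre (a%:R : 'F_p) = -1.
Proof.
move=> p_pr p4 [co_a nonsq].
have a_neq0 : a%:R != 0 :> 'F_p.
  by rewrite (@natr_Fp_eq _ _ 0) // mod0n -/(dvdn _ _)
    -prime_coprime // coprime_sym.
case/orP: (legendre_neq0 p_pr p4 a_neq0) => /eqP // a1; case: nonsq.
(* [(p - 1) / 2 + 1] is even, so a power of [a] is a square root of [a]. *)
have [Eh _] := half_mod4_3 p4.
exists (a ^ ((p - 3) %/ 4).+1)%N; apply/eqP; rewrite -natr_Fp_eq // -expnM.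
have -> : (((p - 3) %/ 4).+1 * 2 = p.-1./2.+1)%N by lia.
by rewrite natrX exprS -/(legendre _) a1 mulr1.
Qed.

(** [c b] stands for the symbol of [q ^ b], and [X'] has the opposite sign because [g] is a
    nonresidue. Thus [c j' = c j] multiplies opposite quadratic classes, and [c j' = - c j] equal
    ones. *)
Lemma res_val_products (R : comNzRingType) (p q s t i j j' : nat) (u v : R)
    (c : nat -> 'F_p) (X X' : nat -> nat -> R) :
    prime p -> prime q -> p = 3 %[mod 4] -> (i < s)%N -> (j < j' <= t)%N ->
    u ^+ (p ^ s) = 1 -> v ^+ (q ^ t) = 1 ->
    (forall k, (c k == 1) || (c k == -1)) ->
    (forall a b, (a <= s)%N -> (b <= t)%N ->
       X a b = res_sum s a u (c b) * val_sum v q t b) ->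
    (forall a b, (a <= s)%N -> (b <= t)%N ->
       X' a b = res_sum s a u (- c b) * val_sum v q t b) ->
  (c j' = c j ->
     X i j * X' i j' =
       ((p - 3) %/ 4 * p ^ (s - i - 1) * totient (q ^ (t - j')))%:R *
         (X i j + X' i j)
       + (totient (p ^ (s - i)) %/ 2 * totient (q ^ (t - j')))%:R *
         (\sum_(i.+1 <= k < s) (X k j + X' k j) + X s j)) /\
  (c j' = - c j ->
     X i j * X' i j' =
       ((p - 3) %/ 4 * p ^ (s - i - 1) * totient (q ^ (t - j')))%:R * X i j
       + ((p + 1) %/ 4 * p ^ (s - i - 1) * totient (q ^ (t - j')))%:R * X' i j).
Proof.
move=> p_pr q_pr p4 i_lt /andP[j_lt j'_le] u1 v1 c1 XE X'E.
have i_le := ltnW i_lt.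
have j_le : (j <= t)%N := leq_trans (ltnW j_lt) j'_le.
rewrite !XE ?X'E // [_ * val_sum _ _ _ j * _]mulrACA (val_sumM q_pr j_lt j'_le v1).
set V := val_sum v q t j; set T := totient _.
split=> ->; last first.
  by rewrite opprK res_sumM_same // !natrM; ring.
rewrite res_sumM_opp //.
have -> : \sum_(i.+1 <= k < s) (X k j + X' k j) + res_sum s s u (c j) * V =
    geom u p s i.+1 * V.
  rewrite res_sum_top -(sum_res_sum u (e := fun=> c j) p_pr p4) // mulrDl.
  congr (_ + _); rewrite big_distrl /= !big_nat; apply: eq_bigr => k /andP[_ k_lt].
  by rewrite XE ?X'E ?(ltnW k_lt) // mulrDl.
by rewrite !natrM; ring.
Qed.

Theorem theorem4p10 (s t p q l : nat) (g : int) (i j j' : nat)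
    (s_ge1 : (1 <= s)%N) (t_ge1 : (1 <= t)%N)
    (p_prime : prime p) (q_prime : prime q) (l_prime : prime l)
    (p_neq_q : p <> q) (p_neq_l : p <> l) (q_neq_l : q <> l)
    (p_odd : odd p) (q_odd : odd q) (p_mod4 : p = 3 %[mod 4])
    (ord_l_ps : mult_order_is (p ^ s) l (totient (p ^ s) %/ 2))
    (ord_l_qt : mult_order_is (q ^ t) l (totient (q ^ t)))
    (gcd_phi : gcdn (totient (p ^ s)) (totient (q ^ t)) = 2%N)
    (g_ps : primitive_root_mod (p ^ s) g) (g_qt : primitive_root_mod (q ^ t) g)
    (i_le : (i <= s - 1)%N) (j_lt : (j < j')%N) (j'_le : (j' <= t)%N) :
  let X := chi p q s t l in
  let X' := chi_star p q s t l g in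
  [/\ (quad_residue p q ->
        X i j * X' i j' =
          ((p - 3) %/ 4 * p ^ (s - i - 1) * totient (q ^ (t - j')))%:R *
            (X i j + X' i j)
          + (totient (p ^ (s - i)) %/ 2 * totient (q ^ (t - j')))%:R *
            (\sum_(i.+1 <= k < s) (X k j + X' k j) + X s j)),
      (quad_nonresidue p q -> ~~ (2 %| j' - j)%N ->
        X i j * X' i j' =
          ((p - 3) %/ 4 * p ^ (s - i - 1) * totient (q ^ (t - j')))%:R * X i j
          + ((p + 1) %/ 4 * p ^ (s - i - 1) * totient (q ^ (t - j')))%:R *
            X' i j)
    & (quad_nonresidue p q -> (2 %| j' - j)%N ->
        X i j * X' i j' =
          ((p - 3) %/ 4 * p ^ (s - i - 1) * totient (q ^ (t - j')))%:R *
            (X i j + X' i j)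
          + (totient (p ^ (s - i)) %/ 2 * totient (q ^ (t - j')))%:R *
            (\sum_(i.+1 <= k < s) (X k j + X' k j) + X s j))].
Proof.
move=> X X'.
have ps_gt1 : (1 < p ^ s)%N by rewrite -(expn0 p) ltn_exp2l ?prime_gt1.
have qt_gt1 : (1 < q ^ t)%N by rewrite -(expn0 q) ltn_exp2l ?prime_gt1.
have n_gt1 : (1 < p ^ s * q ^ t)%N by nia.
have i_lt : (i < s)%N by rewrite -(subnK s_ge1) addn1 ltnS.
(* A natural number representing the integer [g], which may be negative, modulo [p ^ s], [q ^ t] and
   their product at once. *)
pose c := `|(g %% (p ^ s * q ^ t)%N)%Z|%N.
have gE m : (1 < m)%N -> (m %| p ^ s * q ^ t)%N -> g%:~R = c%:R :> 'Z_m.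
  move=> m_gt1 /dvdnP[d dE].
  rewrite {1}(divz_eq g (p ^ s * q ^ t)%N) intrD intrM -!pmulrn dE natrM.
  rewrite pchar_Zp // !mulr0 add0r -dE pmulrn /c gez0_abs //.
  by rewrite modz_ge0 // eqz_nat -lt0n ltnW.
have c_ps : primitive_root_mod (p ^ s) c.
  by move: g_ps; rewrite /primitive_root_mod /mult_order_is gE ?dvdn_mulr.
have c_qt : primitive_root_mod (q ^ t) c.
  by move: g_qt; rewrite /primitive_root_mod /mult_order_is gE ?dvdn_mull.
have co_cp := mult_order_coprime s_ge1 ps_gt1 c_ps.
have co_cq := mult_order_coprime t_ge1 qt_gt1 c_qt.
have c_gt0 : (0 < c)%N.
  rewrite lt0n; apply: contraTneq co_cp => ->.
  by rewrite /coprime gcd0n gtn_eqF ?prime_gt1.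
have legc := legendre_generator p_prime p_mod4 s_ge1 ord_l_ps c_ps.
have [u [v [u1 v1 cosetE]]] := coset_sumE p_prime q_prime p_neq_q p_mod4 s_ge1
  t_ge1 ord_l_ps ord_l_qt gcd_phi.
pose e k := legendre ((q ^ k)%:R : 'F_p).
have q_neq0 : q%:R != 0 :> 'F_p.
  rewrite (@natr_Fp_eq _ _ 0) // mod0n -/(dvdn _ _) dvdn_prime2 //; exact/eqP.
have e1 k : (e k == 1) || (e k == -1).
  by rewrite /e natrX; apply: legendre_neq0 => //; rewrite expf_neq0.
have XE a b : (a <= s)%N -> (b <= t)%N ->
    X a b = res_sum s a u (e b) * val_sum v q t b.
  by move=> a_le b_le; rewrite /X /chi (cosetE a b 1%N) ?muln1 ?coprime1n.
have X'E a b : (a <= s)%N -> (b <= t)%N ->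
    X' a b = res_sum s a u (- e b) * val_sum v q t b.
  move=> a_le b_le; rewrite /X' /chi_star (cosetE a b c) //.
    by rewrite natrM legendreM legc mulrN1.
  by rewrite intrM -pmulrn (gE _ n_gt1) // -natrM.
have jj' : (j < j' <= t)%N by rewrite j_lt.
have [same opp] := res_val_products p_prime q_prime p_mod4 i_lt jj' u1 v1 e1 XE X'E.
have eE k : e k = legendre (q%:R : 'F_p) ^+ k by rewrite /e natrX legendreX.
have j'E : j' = (j + (j' - j))%N by rewrite subnKC // ltnW.
(* The symbols at [j] and [j'] differ by that of [q] to the power [j' - j]: this is -1 exactly when
   [q] is a nonresidue and [j' - j] is odd. *)
split.
- by move=> /(quad_residue_legendre p_prime p_mod4) q1; apply: same;
    rewrite !eE q1 !expr1n.
- move=> /(quad_nonresidue_legendre p_prime p_mod4) q1.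
  rewrite dvdn2 negbK => d_odd.
  by apply: opp; rewrite !eE q1 j'E exprD -[in X in _ * X]signr_odd d_odd mulrN1.
move=> /(quad_nonresidue_legendre p_prime p_mod4) q1; rewrite dvdn2 => d_even.
by apply: same; rewrite !eE q1 j'E exprD
  -[X in _ * X]signr_odd (negPf d_even) mulr1.
Qed.
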